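(* Let $X$ be a real Banach space which contains an isometric copy of $c_0$. Then there exists a maximal monotone operator $T:X\rightrightarrows X^*$ which is not of Gossez type (D).
   Context: $c_0$ is the space of real sequences converging to $0$ with the sup-norm. ''$X$ contains an isometric copy of $c_0$'' means there is a linear isometry from $c_0$ into $X$. A point-to-set operator $T:U\rightrightarrows V$ is a map from $U$ to the power set of $V$; its graph is $\operatorname{Gr}(T)=\{(u,v)\in U\times V \mid v\in T(u)\}$. For a real Banach space $X$ with topological dual $X^*$, $\langle x,x^*\rangle=\langle x^*,x\rangle=x^*(x)$ is the duality product, and $X$ is identified with its canonical image in $X^{**}$. An operator $T:X\rightrightarrows X^*$ is monotone if $\langle x-y,x^*-y^*\rangle\ge 0$ for all $(x,x^* ),(y,y^* )\in\operatorname{Gr}(T)$, and maximal monotone if it is monotone and its graph is maximal with respect to inclusion among graphs of monotone operators in $X\times X^*$. Gossez's monotone closure of a maximal monotone $T:X\rightrightarrows X^*$ is the operator $\widetilde T:X^{**}\rightrightarrows X^*$ with graph $\operatorname{Gr}(\widetilde T)=\{(x^{**},x^* )\in X^{**}\times X^* \mid \langle x^*-y^*,x^{**}-y\rangle\ge 0\ \ \forall (y,y^* )\in\operatorname{Gr}(T)\}$. A maximal monotone $T:X\rightrightarrows X^*$ is of Gossez type (D) if for every $(x^{**},x^* )\in\operatorname{Gr}(\widetilde T)$ there is a bounded net $((x_i,x_i^* ))_{i\in I}$ in $\operatorname{Gr}(T)$ converging to $(x^{**},x^* )$ in the $\sigma(X^{**},X^* )\times$strong topology of $X^{**}\times X^*$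 (i.e., $x_i\to x^{**}$ weak-$*$ in $X^{**}$ and $x_i^*\to x^*$ in norm). *)

(* Defs.v *)
From HB Require Import structures.
From mathcomp Require Import all_boot all_order all_algebra.
From mathcomp Require Import all_classical all_reals all_analysis.
Import Order.TTheory GRing.Theory Num.Theory.
Import numFieldNormedType.Exports.
Set Implicit Arguments.
Unset Strict Implicit.
Unset Printing Implicit Defensive.
Local Open Scope classical_set_scope.
Local Open Scope ring_scope.

Definition bounded_fun_on (R : realType) (T : Type) (A : set T) (f : T -> R) :=
  exists M : R, forall x, A x -> `|f x| <= M.

Definition supnorm (R : realType) (T : Type) (A : set T) (f : T -> R) : R :=
  sup [set `|f x| | x in A].

Section supnorm_theory.
Context {R : realType} {T : Type} (A : set T).
Hypothesis A0 : A !=set0.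
Implicit Types f g : T -> R.

Lemma supnorm_ub f x : bounded_fun_on A f -> A x -> `|f x| <= supnorm A f.
Proof.
move=> [M fM] Ax; apply: ub_le_sup; last by exists x.
by exists M => _ [y Ay <-]; exact: fM.
Qed.

Lemma supnorm_le f M : (forall x, A x -> `|f x| <= M) -> supnorm A f <= M.
Proof.
move=> fM; apply: ge_sup; last by move=> _ [y Ay <-]; exact: fM.
by case: A0 => x Ax; exists `|f x|; exists x.
Qed.

Lemma supnorm_ge0 f : bounded_fun_on A f -> 0 <= supnorm A f.
Proof.
by move=> bf; case: A0 => x Ax; apply: le_trans (supnorm_ub bf Ax).
Qed.

Lemma supnormD f g : bounded_fun_on A f -> bounded_fun_on A g ->
  supnorm A (fun x => f x + g x) <= supnorm A f + supnorm A g.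
Proof.
move=> bf bg; apply: supnorm_le => x Ax.
by rewrite (le_trans (ler_normD _ _))// lerD// supnorm_ub.
Qed.

Lemma bounded_fun_onZ (l : R) f :
  bounded_fun_on A f -> bounded_fun_on A (fun x => l * f x).
Proof.
move=> [M fM]; exists (`|l| * M) => x Ax.
by rewrite normrM ler_wpM2l// fM.
Qed.

Lemma supnormZ (l : R) f : bounded_fun_on A f ->
  supnorm A (fun x => l * f x) = `|l| * supnorm A f.
Proof.
move=> bf; apply/eqP; rewrite eq_le; apply/andP; split.
  by apply: supnorm_le => x Ax; rewrite normrM ler_wpM2l// supnorm_ub.
have [->|l0] := eqVneq l 0.
  rewrite normr0 mul0r; apply: supnorm_ge0.
  by exists 0 => x _; rewrite mul0r normr0.
rewrite mulrC -ler_pdivlMr ?normr_gt0//; apply: supnorm_le => x Ax.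
rewrite ler_pdivlMr ?normr_gt0// mulrC -normrM.
by apply: (@supnorm_ub (fun x => l * f x)) => //; exact: bounded_fun_onZ.
Qed.

End supnorm_theory.

Definition linear_continuous_functional (R : realType) (V : normedModType R) :
  {pred V -> R^o} := fun f => `[< linear f /\ continuous f >].

Record dual (R : realType) (V : normedModType R) := Dual {
  dual_fun :> V -> R^o ;
  _ : dual_fun \in @linear_continuous_functional R V }.

Section dual_lmodule.
Context {R : realType} (V : normedModType R).

Lemma linear_continuous_functional_closed :
  subsemimod_closed (@linear_continuous_functional R V).
Proof.
split; first split.
- apply/asboolP; split; last by move=> x; exact: cvg_cst.
  by move=> a u v /=; rewrite /GRing.zero/= scaler0 addr0.
- move=> f g /asboolP[lf cf] /asboolP[lg cg]; apply/asboolP; split.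
    move=> a u v; rewrite !fctE lf lg scalerDr -!addrA; congr (_ + _).
    by rewrite addrCA.
  by move=> x; apply: cvgD; [exact: cf|exact: cg].
- move=> l f /asboolP[lf cf]; apply/asboolP; split.
    move=> a u v; rewrite !fctE lf scalerDr; congr (_ + _).
    by rewrite !scalerA mulrC.
  by move=> x; apply: cvgZl_tmp; exact: cf.
Qed.

HB.instance Definition _ := [isSub for @dual_fun R V].
HB.instance Definition _ := [Choice of dual V by <:].
HB.instance Definition _ := GRing.SubChoice_isSubLmodule.Build R (V -> R^o)
  (@linear_continuous_functional R V) (dual V)
  linear_continuous_functional_closed.

End dual_lmodule.

Section dual_normed.
Context {R : realType} (V : normedModType R).
Implicit Types f g : dual V.

Lemma dual_linear f : linear f.
Proof. by case: f => f /= /asboolP[]. Qed.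

Lemma dual_continuous f : continuous f.
Proof. by case: f => f /= /asboolP[]. Qed.

HB.instance Definition _ f :=
  GRing.isLinear.Build R V R^o _ (dual_fun f) (dual_linear f).

Lemma dualP f g : (forall x, f x = g x) -> f = g.
Proof. by move=> fg; apply: val_inj; apply/funext. Qed.

Lemma dualD f g x : (f + g) x = f x + g x. Proof. by []. Qed.

Lemma dualN f x : (- f) x = - f x. Proof. by []. Qed.

Lemma dualB f g x : (f - g) x = f x - g x. Proof. by []. Qed.

Lemma dualZ (l : R) f x : (l *: f) x = l * f x. Proof. by []. Qed.

Let unit_ball0 : [set x : V | `|x| <= 1] !=set0.
Proof. by exists 0; rewrite /= normr0. Qed.

Definition dual_norm f : R := supnorm [set x | `|x| <= 1] f.

Lemma dual_bounded f : bounded_fun_on [set x | `|x| <= 1] f.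
Proof.
have : bounded_near f (nbhs (0 : V)).
  by apply/linear_bounded_continuous; exact: dual_continuous.
move=> /linear_boundedP fr.
have [r [r0 {}fr]] : exists r, 0 < r /\ forall x, `|f x| <= r * `|x|.
  near (+oo_R) => r; exists r; split; first by near: r; exact: nbhs_pinfty_gt.
  by near: r.
exists r => x /= x1; rewrite (le_trans (fr x))// -[leRHS]mulr1.
by rewrite ler_wpM2l// ltW.
Unshelve. all: by end_near. Qed.

Lemma ler_dual_norm f x : `|f x| <= dual_norm f * `|x|.
Proof.
have [->|x0] := eqVneq x 0; first by rewrite linear0 !normr0 mulr0.
rewrite -ler_pdivrMr ?normr_gt0//.
have -> : `|f x| / `|x| = `|f (`|x|^-1 *: x)|.
  by rewrite linearZ/= normrM normfV normr_id mulrC.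
apply: supnorm_ub; first exact: dual_bounded.
by rewrite /= normrZ normfV normr_id mulVf// normr_eq0.
Qed.

Let dual_normD f g : dual_norm (f + g) <= dual_norm f + dual_norm g.
Proof. by apply: supnormD => //; exact: dual_bounded. Qed.

Let dual_normZ (l : R) f : dual_norm (l *: f) = `|l| * dual_norm f.
Proof. by apply: supnormZ => //; exact: dual_bounded. Qed.

Let dual_norm0_eq0 f : dual_norm f = 0 -> f = 0.
Proof.
move=> f0; apply: dualP => x; apply/eqP; rewrite -normr_le0.
by rewrite (le_trans (ler_dual_norm f x))// f0 mul0r.
Qed.

HB.instance Definition _ := Lmodule_isNormed.Build R (dual V)
  dual_normD dual_normZ dual_norm0_eq0.

Lemma dual_normE f : `|f| = supnorm [set x | `|x| <= 1] f.
Proof. by []. Qed.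

Lemma ler_dual f x : `|f x| <= `|f| * `|x|.
Proof. exact: ler_dual_norm. Qed.

End dual_normed.

Section canonical_embedding.
Context {R : realType} (V : normedModType R).

Lemma dual_eval_subproof (x : V) :
  (fun f : dual V => f x) \in @linear_continuous_functional R (dual V).
Proof.
pose e := fun f : dual V => (f x : R^o).
have le : linear e by [].
pose L := GRing.isLinear.Build R (dual V) R^o _ e le.
pose E : {linear dual V -> R^o} := HB.pack e L.
apply/asboolP; split => //.
apply: (@bounded_linear_continuous _ _ _ E).
apply/linear_boundedP; exists `|x|; split; first exact: num_real.
move=> r /ltW xr f; rewrite (le_trans (ler_dual f x))// mulrC.
by rewrite ler_wpM2r.
Qed.

Definition bidual_embedding (x : V) : dual (dual V) :=
  Dual (dual_eval_subproof x).

End canonical_embedding.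

Definition vanishing_seq (R : realType) : {pred nat -> R^o} :=
  fun u => `[< u @ \oo --> (0 : R^o) >].

Record c0 (R : realType) := C0 {
  c0_seq :> nat -> R^o ;
  _ : c0_seq \in @vanishing_seq R }.

Section c0_normed.
Context {R : realType}.

Lemma vanishing_seq_closed : subsemimod_closed (@vanishing_seq R).
Proof.
split; first split.
- by apply/asboolP; exact: cvg_cst.
- move=> u v /asboolP cu /asboolP cv; apply/asboolP.
  by rewrite -[X in _ --> X](addr0 (0 : R^o)); exact: cvgD.
- move=> l u /asboolP cu; apply/asboolP.
  by rewrite -[X in _ --> X](scaler0 R^o l); exact: cvgZl_tmp.
Qed.

HB.instance Definition _ := [isSub for @c0_seq R].
HB.instance Definition _ := [Choice of c0 R by <:].
HB.instance Definition _ := GRing.SubChoice_isSubLmodule.Build R (nat -> R^o)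
  (@vanishing_seq R) (c0 R) vanishing_seq_closed.

Implicit Types u v : c0 R.

Lemma c0_cvg u : u @ \oo --> (0 : R^o).
Proof. by case: u => u /= /asboolP. Qed.

Let nat_setT0 : [set: nat] !=set0.
Proof. by exists 0%N. Qed.

Lemma c0_bounded u : bounded_fun_on [set: nat] u.
Proof.
have cu : cvgn (u : nat -> R^o) by apply/cvg_ex; exists 0; exact: c0_cvg.
have /pinfty_ex_gt0[M _ /= uM] := cvg_seq_bounded cu.
by exists M => n _; exact: uM.
Qed.

Definition c0_norm u : R := supnorm [set: nat] u.

Let c0_normD u v : c0_norm (u + v) <= c0_norm u + c0_norm v.
Proof. by apply: supnormD => //; exact: c0_bounded. Qed.

Let c0_normZ (l : R) u : c0_norm (l *: u) = `|l| * c0_norm u.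
Proof. by apply: supnormZ => //; exact: c0_bounded. Qed.

Let c0_norm0_eq0 u : c0_norm u = 0 -> u = 0.
Proof.
move=> u0; apply: val_inj; apply/funext => n; apply/eqP; rewrite -normr_le0.
by rewrite -u0; apply: supnorm_ub => //; exact: c0_bounded.
Qed.

HB.instance Definition _ := Lmodule_isNormed.Build R (c0 R)
  c0_normD c0_normZ c0_norm0_eq0.

Lemma c0_normE u : `|u| = supnorm [set: nat] u.
Proof. by []. Qed.

End c0_normed.

Definition contains_isometric_copy_of_c0 (R : realType) (X : normedModType R) :=
  exists J : {linear c0 R -> X}, forall u, `|J u| = `|u|.

(* A point-to-set operator from U to V is a function U -> set V. *)

Definition graph (U V : Type) (T : U -> set V) : set (U * V) :=
  [set p | T p.1 p.2].

Section monotone_operators.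
Context {R : realType} {X : normedModType R}.
Implicit Types T S : X -> set (dual X).

Definition monotone T := forall p q : X * dual X,
  graph T p -> graph T q -> 0 <= (p.2 - q.2) (p.1 - q.1) :> R.

Definition maximal_monotone T := monotone T /\
  forall S, monotone S -> graph T `<=` graph S -> graph S = graph T.

Definition gossez_closure T : dual (dual X) -> set (dual X) :=
  fun xx f => forall q : X * dual X, graph T q ->
    0 <= (xx - bidual_embedding q.1) (f - q.2) :> R.

End monotone_operators.

Definition directed_preorder (I : Type) (le : I -> I -> Prop) :=
  [/\ inhabited I, forall i, le i i,
      forall i j k, le i j -> le j k -> le i k &
      forall i j, exists k, le i k /\ le j k].

(* [net x @ net_filter le --> l] is convergence of the net x to l. *)
Definition net_filter (I : Type) (le : I -> I -> Prop) : set_system I :=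
  filter_from setT (fun i0 => [set i | le i0 i]).

Lemma net_filter_proper (I : Type) (le : I -> I -> Prop) :
  directed_preorder le -> ProperFilter (net_filter le).
Proof.
move=> [[i0] lexx le_trans dir]; apply: filter_from_proper; last first.
  by move=> i _; exists i; exact: lexx.
apply: filter_from_filter; first by exists i0.
move=> i j _ _; have [k [ik jk]] := dir i j; exists k => // l kl.
by split; [exact: le_trans ik kl|exact: le_trans jk kl].
Qed.

(* Convergence in the weak-* topology sigma(V^*, V), which is the topology of
   pointwise convergence on V. *)
Definition weak_star_cvg (R : realType) (V : normedModType R) (I : Type)
    (f : I -> dual V) (F : set_system I) (g : dual V) :=
  forall x : V, (fun i => f i x) @ F --> g x.

Definition gossez_type_D (R : realType) (X : normedModType R)
    (T : X -> set (dual X)) :=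
  forall (xx : dual (dual X)) (f : dual X), graph (gossez_closure T) (xx, f) ->
  exists (I : Type) (le : I -> I -> Prop) (net : I -> X * dual X),
    [/\ directed_preorder le,
        forall i, graph T (net i),
        exists M : R, forall i, `|net i| <= M,
        weak_star_cvg (fun i => bidual_embedding (net i).1) (net_filter le) xx
      & (fun i => (net i).2) @ net_filter le --> f].

(* Main.v *)
Require Import Defs.
From HB Require Import structures.
From mathcomp Require Import all_boot all_order all_algebra.
From mathcomp Require Import all_classical all_reals all_analysis.
From mathcomp Require Import lra ring.
Import Order.TTheory GRing.Theory Num.Theory.
Import numFieldNormedType.Exports.
Set Implicit Arguments.
Unset Strict Implicit.
Unset Printing Implicit Defensive.
Local Open Scope classical_set_scope.
Local Open Scope ring_scope.

(* Let J : c0 -> X be an isometry, e_n = J(unit_n), and for f in X^* put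
   S_n(f) = f(e_0) + ... + f(e_(n-1)), with limit S(f), which exists because
   sum |f(e_n)| <= |f|. The operator is T(J u) = {f | u_n = S_n(f) + S_(n+1)(f)}.
   The identity sum_(k<n) (S_k + S_(k+1)) (S_(k+1) - S_k) = S_n^2 gives f(x) >= 0
   on the graph of T, which is linear, so T is monotone; as u_n -> 0, moreover
   S(f) = 0 and hence f(x) = 0 on the graph.

   Maximality. Let (x, g) be monotonically related to T. By Hahn-Banach x = J u,
   since T(0) contains the annihilator of J(c0). Testing against functionals f
   with values 1 at e_m, -1 at e_(m+1) and 0 at the other e_n gives
   u_n = S_n(g) + S_(n+1)(g) + c. The limit forces c = - 2 S(g), so that
   0 <= g(x) = - S(g)^2, whence S(g) = c = 0 and (x, g) is in the graph.

   T is not of type (D). Let g extend the coordinate functional u |-> u_0. The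
   pair (f |-> 2 S(f) - f(e_0), g) lies in Gossez's closure, but S(g) = 1 while
   S = 0 on the range of T and S is norm-continuous. *)

(** * Hahn-Banach through minimal sublinear functionals *)

Definition sublinear (R : realType) (V : lmodType R) (q : V -> R) :=
  (forall x y, q (x + y) <= q x + q y) /\
  (forall (t : R) x, 0 <= t -> q (t *: x) = t * q x).

Section sublinear_theory.
Context {R : realType} {V : lmodType R}.
Implicit Types (p q r : V -> R) (x y : V).

Lemma sublinear0 q : sublinear q -> q 0 = 0.
Proof. by case=> _ /(_ 0 0 (lexx 0)); rewrite scale0r mul0r. Qed.

Lemma sublinear_geN q x : sublinear q -> - q (- x) <= q x.
Proof.
move=> sq; have [qD _] := sq.
by have := qD x (- x); rewrite subrr (sublinear0 sq) lerNl => ?; lra.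
Qed.

(** The minorant [b] bounds each set of values below, so that [inf] is a genuine infimum. A
    one-sided scaling hypothesis suffices: applied to [t^-1] it yields the converse inequality. *)
Lemma sublinear_inf (I : Type) (A : set I) (F : I -> V -> R) (b : V -> R) :
  (forall i x, A i -> b x <= F i x) ->
  (forall i j x y, A i -> A j -> exists2 k, A k & F k (x + y) <= F i x + F j y) ->
  (forall i (t : R) x, A i -> 0 < t -> exists2 k, A k & F k (t *: x) <= t * F i x) ->
  (forall i, A i -> 0 <= F i 0) -> (exists2 i, A i & F i 0 <= 0) ->
  sublinear (fun x => inf [set F i x | i in A]).
Proof.
move=> Fb FD FZ F0 [i0 Ai0 Fi0]; set q := fun x => _.
have q_le i x : A i -> q x <= F i x.
  move=> Ai; apply: ge_inf; last by exists i.
  by exists (b x) => _ [j Aj <-]; exact: Fb.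
have q_ge x c : (forall i, A i -> c <= F i x) -> c <= q x.
  move=> cF; apply: lb_le_inf; first by exists (F i0 x), i0.
  by move=> _ [j Aj <-]; exact: cF.
have q0 : q 0 = 0.
  by apply/eqP; rewrite eq_le (le_trans (q_le _ _ Ai0))//= q_ge.
have qZ t x : 0 < t -> q (t *: x) <= t * q x.
  move=> t0; rewrite mulrC -ler_pdivrMr//; apply: q_ge => i Ai.
  rewrite ler_pdivrMr// mulrC; have [k Ak] := FZ i t x Ai t0.
  exact/le_trans/q_le.
split=> [x y|t x].
  rewrite -lerBlDr; apply: (q_ge) => i Ai.
  rewrite lerBlDr -lerBlDl; apply: (q_ge) => j Aj.
  rewrite lerBlDl; have [k Ak] := FD i j x y Ai Aj.
  exact/le_trans/q_le.
rewrite le_eqVlt => /predU1P[<-|t0]; first by rewrite scale0r mul0r.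
apply/eqP; rewrite eq_le qZ//= mulrC -ler_pdivlMr//.
rewrite -[in leLHS](scalerK (lt0r_neq0 t0) x) mulrC.
by apply: qZ; rewrite invr_gt0.
Qed.

(** Zorn's lemma for the reversed pointwise order on the sublinear minorants of [p]. A nonempty
    chain is bounded by its pointwise infimum, finite because every minorant dominates
    [- p (- x)]. *)
Lemma sublinear_minimal p : sublinear p ->
  exists q, [/\ sublinear q, forall x, q x <= p x &
    forall r, sublinear r -> (forall x, r x <= q x) -> r = q].
Proof.
move=> sp; pose T := {q | sublinear q /\ forall x, q x <= p x}.
pose Rel (s t : T) := `[< forall x, sval t x <= sval s x >].
have pT : sublinear p /\ forall x, p x <= p x by [].
have [|r s t||A Atot|[q [sq qp]] qmin] := @Zorn T Rel.
- by move=> t; apply/asboolP.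
- by move=> /asboolP rs /asboolP st; apply/asboolP => x; exact: le_trans (rs x).
- move=> [s sP] [t tP] /asboolP/= ts /asboolP/= st; apply: eq_exist => /=.
  by apply/funext => x; apply/eqP; rewrite eq_le st ts.
- have [->|/set0P[t0 At0]] := eqVneq A set0; first by exists (exist _ p pT).
  pose q x := inf [set sval t x | t in A].
  have lbA (t : T) x : - p (- x) <= sval t x.
    case: t => t [st tp] /=; apply: le_trans (sublinear_geN x st).
    by rewrite lerN2.
  have q_le (t : T) x : A t -> q x <= sval t x.
    move=> At; apply: ge_inf; last by exists t.
    by exists (- p (- x)) => _ [s As <-]; exact: lbA.
  have sq : sublinear q.
    apply: (@sublinear_inf _ A (fun t => sval t) (fun x => - p (- x))).
    + by move=> t x _; exact: lbA.
    + move=> s t x y As At.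
      have [/asboolP st|/asboolP ts] := Atot _ _ As At.
        exists t => //; rewrite (le_trans ((svalP t).1.1 x y))// lerD2r.
        exact: st.
      exists s => //; rewrite (le_trans ((svalP s).1.1 x y))// lerD2l.
      exact: ts.
    + by move=> t l x At l0; exists t => //; rewrite (svalP t).1.2// ltW.
    + by move=> t _; rewrite (sublinear0 (svalP t).1).
    + by exists t0 => //; rewrite (sublinear0 (svalP t0).1).
  have qp x : q x <= p x := le_trans (q_le _ x At0) ((svalP t0).2 x).
  exists (exist _ q (conj sq qp)) => s As; apply/asboolP => x /=.
  exact: q_le.
- exists q; split => // r sr rq.
  have rp x : r x <= p x := le_trans (rq x) (qp x).
  have /qmin/(congr1 sval)// : Rel (exist _ q (conj sq qp)) (exist _ r (conj sr rp)).
  exact/asboolP.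
Qed.

(* The shift of q along the ray of y: it is the largest sublinear minorant of q
   whose value at - y is at most - q y. *)
Lemma sublinear_shift q y : sublinear q -> exists r, [/\ sublinear r,
  forall x, r x <= q x & forall x, r x <= q (x + y) - q y].
Proof.
move=> sq; have [qD qZ] := sq.
pose F t x := q (x + t *: y) - t * q y.
have Fb t x : 0 <= t -> - q (- x) <= F t x.
  move=> t0; have := qD (- x) (x + t *: y).
  by rewrite addKr qZ// /F; lra.
have sr : sublinear (fun x => inf [set F t x | t in [set t | 0 <= t]]).
  apply: (sublinear_inf (b := fun x => - q (- x))) => //=.
  - move=> s t x z s0 t0; exists (s + t); first exact: addr_ge0.
    rewrite /F scalerDl addrACA mulrDl.
    by have := qD (x + s *: y) (z + t *: y); lra.
  - move=> s t x s0 t0; exists (t * s); first by rewrite mulr_ge0// ltW.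
    by rewrite /F -scalerA -scalerDr (qZ _ _ (ltW t0)) mulrBr mulrA.
  - by move=> t t0; rewrite /F add0r qZ// subrr.
  - by exists 0 => //; rewrite /F scale0r addr0 mul0r subr0 (sublinear0 sq).
have r_le t x : 0 <= t -> inf [set F t x | t in [set t | 0 <= t]] <= F t x.
  move=> t0; apply: ge_inf; last by exists t.
  by exists (- q (- x)) => _ [s s0 <-]; exact: Fb.
eexists; split; first exact: sr.
- move=> x; apply: le_trans (r_le 0 x (lexx 0)) _.
  by rewrite /F scale0r addr0 mul0r subr0.
- move=> x; apply: le_trans (r_le 1 x ler01) _.
  by rewrite /F scale1r mul1r.
Qed.

(* A minimal sublinear functional coincides with its shifts, hence is linear. *)
Lemma hahn_banach p y : sublinear p ->
  exists f : V -> R, [/\ linear (f : V -> R^o), forall x, f x <= p x & f y = p y].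
Proof.
(* At [- y] the shift is at most [- p y]; this later forces [p y <= f y]. *)
move=> sp; have [p' [sp' p'p p'y]] := sublinear_shift y sp.
have [f [sf fp' fmin]] := sublinear_minimal sp'.
have fD x z : f (x + z) = f x + f z.
  have [r [sr rf rz]] := sublinear_shift z sf.
  apply/eqP; rewrite eq_le sf.1/= -lerBrDr.
  by rewrite (le_trans _ (rz x))// (fmin r).
have f0 := sublinear0 sf.
have fN x : f (- x) = - f x.
  by apply/eqP; rewrite -subr_eq0 opprK -fD addNr f0 eqxx.
have fZ t x : f (t *: x) = t * f x.
  have [t0|t0] := leP 0 t; first exact: sf.2.
  by rewrite -[t]opprK scaleNr fN sf.2 ?oppr_ge0 ?ltW// !mulNr.
exists f; split.
- by move=> t x z; rewrite fD fZ.
- by move=> x; exact: le_trans (p'p x).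
- apply/eqP; rewrite eq_le (le_trans (fp' y))//=.
  have := le_trans (fp' (- y)) (p'y (- y)).
  by rewrite addNr (sublinear0 sp) sub0r fN lerN2.
Qed.

End sublinear_theory.

(** * Continuous functionals and the distance to a subspace *)

Section functionals.
Context {R : realType} {V : normedModType R}.

Lemma bounded_linear_dual (f : V -> R^o) (C : R) : linear f ->
  (forall x, `|f x| <= C * `|x|) -> exists g : dual V, forall x, g x = f x.
Proof.
move=> lf fC; pose L := GRing.isLinear.Build R V R^o _ f lf.
pose F : {linear V -> R^o} := HB.pack f L.
have fP : f \in @linear_continuous_functional R V.
  apply/asboolP; split => //; apply: (@bounded_linear_continuous _ _ _ F).
  apply/linear_boundedP; exists C; split; first exact: num_real.
  by move=> r /ltW Cr x; rewrite (le_trans (fC x))// ler_wpM2r.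
by exists (Dual fP).
Qed.

(** Hahn-Banach for the distance [p] to the subspace [M]: it is at most the norm, at most 0 on [M],
    and at least [d] at [x]. *)
Lemma dist_functional (M : set V) (x : V) (d : R) : M 0 ->
  (forall y z, M y -> M z -> M (y + z)) ->
  (forall (l : R) y, M y -> M (l *: y)) ->
  (forall y, M y -> d <= `|x - y|) ->
  exists f : dual V, [/\ forall y, M y -> f y = 0 :> R,
    forall y, `|f y| <= `|y| & d <= f x].
Proof.
move=> M0 MD MZ dM; pose p y := inf [set `|y - m| | m in M].
have p_le m y : M m -> p y <= `|y - m|.
  move=> Mm; apply: ge_inf; last by exists m.
  by exists 0 => _ [z _ <-].
have sp : sublinear p.
  apply: (@sublinear_inf _ _ _ M (fun m y => `|y - m|) (fun=> 0)) => //.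
  - move=> y z a b My Mz; exists (y + z); first exact: MD.
    by rewrite opprD addrACA ler_normD.
  - move=> y t z My t0; exists (t *: y); first exact: MZ.
    by rewrite -scalerBr normrZ gtr0_norm.
  - by exists 0 => //; rewrite subrr normr0.
have [f [lf fp fx]] := hahn_banach x sp.
have p_norm y : p y <= `|y| by have := p_le 0 y M0; rewrite subr0.
pose L := GRing.isLinear.Build R V R^o _ (f : V -> R^o) lf.
pose F : {linear V -> R^o} := HB.pack (f : V -> R^o) L.
have fN y : f (- y) = - f y := linearN F y.
have f_norm y : `|f y| <= `|y|.
  rewrite ler_norml (le_trans (fp y))// andbT lerNl -fN -normrN.
  exact: le_trans (fp _) _.
have [|g gE] := @bounded_linear_dual f 1 lf; first by move=> y; rewrite mul1r.
exists g; split=> [y My|y|]; rewrite gE //; last first.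
  rewrite fx; apply: lb_le_inf; first by exists `|x - 0|, 0.
  by move=> _ [m Mm <-]; exact: dM.
have p0 z : M z -> p z <= 0.
  by move=> Mz; rewrite (le_trans (p_le _ _ Mz))// subrr normr0.
apply/eqP; rewrite eq_le (le_trans (fp y) (p0 _ My))/=.
rewrite -oppr_le0 -fN (le_trans (fp _))// p0//.
by rewrite -scaleN1r; exact: MZ.
Qed.

End functionals.

(** * Truncations and unit vectors in [c0] *)

Section c0_theory.
Context {R : realType}.
Implicit Types u v : c0 R.

Lemma c0P u v : (forall n, u n = v n) -> u = v.
Proof. by move=> uv; apply: val_inj; apply/funext. Qed.

Lemma c0_norm_ge u n : `|u n| <= `|u|.
Proof. by apply: supnorm_ub => //; exact: c0_bounded. Qed.

Lemma c0_norm_le u (C : R) : (forall n, `|u n| <= C) -> `|u| <= C.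
Proof. by move=> uC; apply: supnorm_le => //; exists 0%N. Qed.

Lemma c0_trunc_subproof (w : nat -> R) (N : nat) :
  (fun n => if (n < N)%N then w n else 0) \in @vanishing_seq R.
Proof.
apply/asboolP; apply: cvg_near_cst; exists N => // n /= Nn.
by rewrite ltnNge Nn.
Qed.

(** Here [w] is an arbitrary sequence, so that sign sequences can be truncated as well. *)
Definition c0_trunc w N : c0 R := C0 (c0_trunc_subproof w N).

Lemma c0_truncE w N n : c0_trunc w N n = if (n < N)%N then w n else 0.
Proof. by []. Qed.

Lemma c0_norm_trunc w N (C : R) : 0 <= C ->
  (forall n, `|w n| <= C) -> `|c0_trunc w N| <= C.
Proof.
move=> C0 wC; apply: c0_norm_le => n; rewrite c0_truncE.
by case: ifP; rewrite ?normr0.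
Qed.

Definition c0_unit m : c0 R := c0_trunc (fun n => (n == m)%:R) m.+1.

Lemma c0_unitE m n : c0_unit m n = (n == m)%:R.
Proof. by rewrite c0_truncE ltnS; case: leqP => // mn; rewrite gtn_eqF. Qed.

Lemma c0_truncS w N : c0_trunc w N.+1 = c0_trunc w N + w N *: c0_unit N.
Proof.
apply: c0P => n; rewrite [RHS]/= c0_truncE.
rewrite -[RHS]/(c0_trunc w N n + w N * c0_unit N n) c0_unitE c0_truncE ltnS.
by case: ltngtP => [|| ->]; rewrite ?mulr0 ?mulr1 ?addr0 ?add0r.
Qed.

Lemma c0_trunc_cvg u : c0_trunc u n @[n --> \oo] --> u.
Proof.
apply/cvgrPdist_le => e e0; have /cvgrPdist_le/(_ e e0) := @c0_cvg _ u.
move=> [N _ uN]; exists N => // n /= Nn; apply: c0_norm_le => k.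
rewrite -[X in `|X|]/(u k - c0_trunc u n k) c0_truncE.
case: ltnP => nk; first by rewrite subrr normr0 ltW.
by rewrite subr0 -normrN -[X in `|X|]sub0r; apply: uN => /=; exact: leq_trans nk.
Qed.

End c0_theory.

Lemma cvgn_unique (R : realType) (w : nat -> R) (a b : R) :
  w @ \oo --> a -> w @ \oo --> b -> a = b.
Proof. by move=> /cvg_lim <-// /cvg_lim <-. Qed.

(** A nonzero slope would give the value -1 at [l = - (a + 1) / b]. Inequalities tested along a
    whole line of the graph thus become equations. *)
Lemma affine_ge0_slope0 (R : realFieldType) (a b : R) : (forall l, 0 <= a + l * b) -> b = 0.
Proof.
move=> ab; apply/eqP/negPn/negP => b0.
have := ab (- (a + 1) / b); rewrite divfK//; lra.
Qed.

(** * Coordinates on the copy of [c0] *)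

Section isometric_c0.
Context {R : realType} {X : normedModType R} (J : {linear c0 R -> X}).
Hypothesis normJ : forall u, `|J u| = `|u|.
Implicit Types (f g : dual X) (u v : c0 R).

Definition coef f (n : nat) : R := f (J (c0_unit n)).

(** [J (c0_unit m)] lies at distance at least 1 from the image of the sequences vanishing at [m];
    the functional separating them is the desired extension. *)
Lemma coordinate_functional m :
  exists f : dual X, (forall u, f (J u) = u m) /\ forall x, `|f x| <= `|x|.
Proof.
pose M := J @` [set u : c0 R | u m = 0].
have [|||_ [v /= vm <-]|f [fM f_norm f1]] :=
    @dist_functional R X M (J (c0_unit m)) 1.
- by exists 0 => //=; rewrite linear0.
- move=> _ _ [u /= um <-] [v /= vm <-]; exists (u + v); last by rewrite linearD.
  by rewrite /= -[LHS]/(u m + v m) um vm addr0.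
- move=> l _ [u /= um <-]; exists (l *: u); last by rewrite linearZ.
  by rewrite /= -[LHS]/(l * u m) um mulr0.
- rewrite -linearB normJ (le_trans _ (c0_norm_ge _ m))//.
  by rewrite -[X in `|X|]/(c0_unit m m - v m) c0_unitE vm eqxx subr0 normr1.
exists f; split => // u.
have fm : f (J (c0_unit m)) = 1 :> R.
  apply/eqP; rewrite eq_le f1 andbT (le_trans (ler_norm _))//.
  rewrite (le_trans (f_norm _))// normJ c0_norm_trunc// => n.
  by case: (n == m); rewrite ?normr1 ?normr0.
pose v := u - u m *: c0_unit m; have fv : f (J v) = 0 :> R.
  apply: fM; exists v => //.
  by rewrite /= -[LHS]/(u m - u m * c0_unit m m) c0_unitE eqxx mulr1 subrr.
have -> : f (J u) = f (J (v + u m *: c0_unit m)) by rewrite subrK.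
by rewrite 2!linearD !linearZ/= fv fm add0r; exact: mulr1.
Qed.

(** The preimage is the sequence of values at [x] of the coordinate functionals: as these have norm
    at most 1, it is uniformly within [e] of [u] once [|x - J u| < e]. *)
Lemma closed_range x :
  (forall e : R, 0 < e -> exists u, `|x - J u| < e) -> exists u, x = J u.
Proof.
move=> xJ; pose c n : dual X := projT1 (cid (coordinate_functional n)).
have cJ n u : c n (J u) = u n by rewrite /c; case: cid => f []/=.
have c_norm n y : `|c n y| <= `|y| by rewrite /c; case: cid => f []/=.
have close e u : `|x - J u| < e -> forall n, `|(c n x : R) - u n| <= e.
  move=> /ltW xu n; rewrite (le_trans _ xu)//.
  by rewrite -(cJ n u) -linearB; exact: c_norm.
have wP : (fun n => c n x) \in @vanishing_seq R.
  apply/asboolP/cvgrPdist_le => e e0.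
  have e20 : 0 < e / 2 by rewrite divr_gt0.
  have [u xu] := xJ _ e20.
  have /cvgrPdist_le/(_ _ e20)[N _ uN] := @c0_cvg _ u.
  exists N => // n Nn; have := uN n Nn; rewrite !sub0r !normrN /= => une.
  have -> : (c n x : R) = ((c n x : R) - u n) + u n by rewrite subrK.
  rewrite (le_trans (ler_normD _ _))// [leRHS]splitr lerD//.
  exact: (close (e / 2)).
exists (C0 wP); apply/eqP; rewrite -subr_eq0 -normr_le0.
apply/ler_addgt0Pr => e e0; rewrite add0r.
have e20 : 0 < e / 2 by rewrite divr_gt0.
have [u xu] := xJ _ e20.
have -> : x - J (C0 wP) = (x - J u) + (J (u - C0 wP)).
  by rewrite linearB addrA subrK.
rewrite (le_trans (ler_normD _ _))// [leRHS]splitr lerD ?ltW// normJ.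
apply: (le_lt_trans _ xu).
apply: c0_norm_le => n; rewrite -[X in `|X|]/(u n - c n x) distrC.
by rewrite -(cJ n u) -linearB; exact: c_norm.
Qed.

Lemma dual_trunc f (w : nat -> R) N :
  f (J (c0_trunc w N)) = \sum_(k < N) w k * coef f k.
Proof.
elim: N => [|N IH].
  have -> : c0_trunc w 0 = 0 by exact: c0P.
  by rewrite !linear0 big_ord0.
by rewrite big_ord_recr /= -IH c0_truncS !linearD !linearZ.
Qed.

Lemma dual_trunc_cvg f u :
  \sum_(k < n) u k * coef f k @[n --> \oo] --> (f (J u) : R^o).
Proof.
under eq_fun do rewrite -dual_trunc.
apply: (@cvg_comp _ _ _ (fun n => J (c0_trunc u n)) f _ (nbhs (J u))); last first.
  exact: dual_continuous.
apply/cvgrPdist_le => e e0; have /cvgrPdist_le/(_ e e0) := @c0_trunc_cvg _ u.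
by apply: filterS => n; rewrite -linearB normJ.
Qed.

(** * Partial sums and total sum of the coefficients *)

Definition psum f n : R := \sum_(k < n) coef f k.

Lemma psumS f n : psum f n.+1 = psum f n + coef f n.
Proof. by rewrite /psum big_ord_recr. Qed.

Lemma psum0 f : psum f 0 = 0. Proof. by rewrite /psum big_ord0. Qed.

Lemma psumD f g n : psum (f + g) n = psum f n + psum g n.
Proof. by rewrite -big_split. Qed.

Lemma psumZ (l : R) f n : psum (l *: f) n = l * psum f n.
Proof. by rewrite /psum mulr_sumr. Qed.

(** Evaluate [f] on the image of the truncated sign sequence, which has norm at most 1. *)
Lemma sum_abs_coef f N : \sum_(k < N) `|coef f k| <= `|f|.
Proof.
have -> : \sum_(k < N) `|coef f k| = f (J (c0_trunc (fun k => Num.sg (coef f k)) N)).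
  by rewrite dual_trunc; apply: eq_bigr => k _; rewrite -normrEsg.
rewrite (le_trans (ler_norm _))// (le_trans (ler_dual _ _))//.
rewrite -[leRHS]mulr1 ler_wpM2l// normJ c0_norm_trunc// => n.
by rewrite normr_sg; case: (_ != 0).
Qed.

Lemma psum_le f n : `|psum f n| <= `|f|.
Proof. exact: le_trans (ler_norm_sum _ _ _) (sum_abs_coef f n). Qed.

Lemma psum_is_cvg f : cvgn (psum f).
Proof.
have -> : psum f = series (coef f).
  by apply/funext => n; rewrite /psum /series /= big_mkord.
apply: normed_cvg.
have -> : [normed series (coef f)] = fun n => \sum_(k < n) `|coef f k|.
  by apply/funext => n; rewrite /= /series /= big_mkord.
apply: nondecreasing_is_cvgn.
  by apply/nondecreasing_seqP => n; rewrite big_ord_recr/= lerDl.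
by exists `|f| => _ [n _ <-]; exact: sum_abs_coef.
Qed.

(** With [coef f] seen in [l^1], this is the pairing with the constant sequence 1, an element of the
    bidual of [c0] outside [c0]. *)
Definition tsum f : R := limn (psum f).

Lemma psum_cvg f : psum f @ \oo --> tsum f.
Proof. exact: psum_is_cvg. Qed.

Lemma tsum_eq f (s : R) : psum f @ \oo --> s -> tsum f = s.
Proof. by move/cvg_lim; apply. Qed.

Lemma tsumD f g : tsum (f + g) = tsum f + tsum g.
Proof.
apply: tsum_eq; have -> := funext (psumD f g).
by apply: cvgD; exact: psum_cvg.
Qed.

Lemma tsumZ (l : R) f : tsum (l *: f) = l * tsum f.
Proof.
apply: tsum_eq; have -> := funext (psumZ l f).
by apply: cvgMl_tmp; exact: psum_cvg.
Qed.

Lemma tsum_le f : `|tsum f| <= `|f|.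
Proof.
have fn : `|psum f n| @[n --> \oo] --> `|tsum f|.
  by apply: cvg_norm; exact: psum_cvg.
rewrite -(cvg_lim _ fn)//; apply: limr_le; first by apply/cvg_ex; exists `|tsum f|.
by apply: nearW => n; exact: psum_le.
Qed.

(** Each summand is a difference of consecutive squares, so the sum telescopes. *)
Lemma sum_psum f n :
  \sum_(k < n) (psum f k + psum f k.+1) * coef f k = psum f n ^+ 2.
Proof.
elim: n => [|n IH]; first by rewrite big_ord0 psum0 expr0n.
by rewrite big_ord_recr /= IH psumS; ring.
Qed.

(** * The operator and its skewness *)

(** Since [tsum f = 0] on the graph, [u n] is the sum of [coef f k] over [k < n] minus that over
    [k > n]: up to sign, Gossez's skew operator on [l^1], here inverted. *)
Definition skewop (x : X) : set (dual X) := [set f | exists u, x = J u /\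
  forall n, u n = psum f n + psum f n.+1].

Lemma skewop_cvg x f : skewop x f -> psum f n ^+ 2 @[n --> \oo] --> (f x : R^o).
Proof.
move=> [u [-> uE]]; have := @dual_trunc_cvg f u.
by under eq_fun do (under eq_bigr do rewrite uE; rewrite sum_psum).
Qed.

Lemma skewop_ge0 x f : skewop x f -> 0 <= f x :> R.
Proof.
move=> /skewop_cvg fx; rewrite -(cvg_lim _ fx)//.
apply: limr_ge; first by apply/cvg_ex; exists (f x).
by apply: nearW => n; exact: sqr_ge0.
Qed.

Lemma psum_avg_cvg g : (psum g n + psum g n.+1) @[n --> \oo] --> tsum g + tsum g.
Proof.
apply: cvgD; first exact: psum_cvg.
by have := @psum_cvg g; rewrite -cvg_shiftS.
Qed.

Lemma skewop_tsum x f : skewop x f -> tsum f = 0.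
Proof.
move=> [u [_ uE]]; have := @c0_cvg _ u.
rewrite (funext uE : (u : nat -> R^o) = _) => u0.
have : tsum f + tsum f = 0 := cvgn_unique (@psum_avg_cvg f) u0; lra.
Qed.

(** [psum f n ^+ 2] tends both to [f x] and to [tsum f ^+ 2], which is 0. *)
Lemma skewop_orth x f : skewop x f -> f x = 0 :> R.
Proof.
move=> Tf; have f0 : psum f n ^+ 2 @[n --> \oo] --> (0 : R).
  have := @psum_cvg f; rewrite (skewop_tsum Tf) => f0.
  rewrite -[X in _ --> X](mul0r (0 : R)) (_ : (fun n => _) = psum f \* psum f).
    exact: cvgM.
  by apply/funext => n; rewrite expr2.
exact: cvgn_unique (skewop_cvg Tf) f0.
Qed.

Lemma skewopD x y f g : skewop x f -> skewop y g -> skewop (x + y) (f + g).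
Proof.
move=> [u [-> uE]] [v [-> vE]]; exists (u + v); split; first by rewrite linearD.
by move=> n; rewrite !psumD -[LHS]/(u n + v n) uE vE addrACA.
Qed.

Lemma skewopZ (l : R) x f : skewop x f -> skewop (l *: x) (l *: f).
Proof.
move=> [u [-> uE]]; exists (l *: u); split; first by rewrite linearZ.
by move=> n; rewrite !psumZ -[LHS]/(l * u n) uE mulrDr.
Qed.

Lemma skewopB x y f g : skewop x f -> skewop y g -> skewop (x - y) (f - g).
Proof. by move=> Tf /(skewopZ (-1)); rewrite !scaleN1r; exact: skewopD. Qed.

Lemma skewop_monotone : Defs.monotone skewop.
Proof. by move=> [x f] [y g] Tf Tg; exact: skewop_ge0 (skewopB Tf Tg). Qed.

(** * Maximality *)

(** All multiples of a functional vanishing on [range J] lie in [skewop 0], so it must vanish at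
    [x]; off the closed range, Hahn-Banach provides one that does not. *)
Lemma related_range x g : (forall y f, skewop y f -> 0 <= (g - f) (x - y) :> R) ->
  exists u, x = J u.
Proof.
move=> Tg; apply: closed_range => e e0; apply: contrapT => /forallNP xJ.
have [||||f [fJ _ ef]] := @dist_functional R X (range J) x e.
- by exists 0 => //; rewrite linear0.
- by move=> _ _ [u _ <-] [v _ <-]; exists (u + v) => //; rewrite linearD.
- by move=> l _ [u _ <-]; exists (l *: u) => //; rewrite linearZ.
- by move=> _ [u _ <-]; rewrite leNgt; apply/negP; exact: xJ.
suff fx : f x = 0 :> R by move: ef; rewrite fx leNgt e0.
have fE n : psum f n = 0 by rewrite /psum big1// => k _; apply: fJ; exists (c0_unit k).
apply: (@affine_ge0_slope0 R (g x)) => l.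
have := Tg 0 (- l *: f); rewrite subr0 dualB dualZ mulNr opprK; apply.
by exists 0; split; [rewrite linear0|move=> n; rewrite !psumZ !fE mulr0 addr0].
Qed.

(** Testing against [(l *: y, l *: f)] gives [0 <= g x - l * (g y + f x)] for all [l], the quadratic
    term [l ^+ 2 * f y] being zero by [skewop_orth]. *)
Lemma related_orth x g : (forall y f, skewop y f -> 0 <= (g - f) (x - y) :> R) ->
  0 <= g x :> R /\ forall y f, skewop y f -> (g y : R) + (f x : R) = 0.
Proof.
move=> Tg; have gE (l : R) y f : skewop y f ->
    0 <= (g x : R) + l * - ((g y : R) + (f x : R)).
  move=> Tf; have := Tg _ _ (skewopZ l Tf).
  have hE (h : dual X) : h (x - l *: y) = (h x : R) - l * (h y : R) :> R.
    by rewrite linearB linearZ.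
  by rewrite dualB dualZ !hE (skewop_orth Tf); lra.
have skewop_00 : skewop 0 0.
  by exists 0; split=> [|n]; rewrite ?linear0// /psum !big1// addr0.
split; first by have := gE 0 _ _ skewop_00; rewrite mul0r addr0.
move=> y f Tf; apply/eqP; rewrite -oppr_eq0; apply/eqP.
by apply: (@affine_ge0_slope0 R (g x)) => l; exact: gE.
Qed.

Lemma skewop_diff m : exists f : dual X, (forall u, f (J u) = u m - u m.+1 :> R) /\
  skewop (J (c0_unit m + c0_unit m.+1)) f.
Proof.
have [a [aJ _]] := coordinate_functional m.
have [b [bJ _]] := coordinate_functional m.+1.
have abJ u : (a - b) (J u) = u m - u m.+1 :> R by rewrite dualB aJ bJ.
exists (a - b); split => //.
(* The coefficients are 1 at [m] and -1 at [m.+1], so only the partial sum of index [m.+1]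
   survives. *)
have psumE n : psum (a - b) n = (n == m.+1)%:R.
  elim: n => [|n IH]; first by rewrite psum0.
  rewrite psumS IH /coef abJ !c0_unitE eqSS [m == n]eq_sym [m.+1 == n]eq_sym.
  by rewrite addrCA subrr addr0.
exists (c0_unit m + c0_unit m.+1); split => // n.
rewrite !psumE -[LHS]/(c0_unit m n + c0_unit m.+1 n) !c0_unitE eqSS.
exact: addrC.
Qed.

Lemma skewop_maximal x g : (forall y f, skewop y f -> 0 <= (g - f) (x - y) :> R) -> skewop x g.
Proof.
move=> Tg; have [u xu] := related_range Tg; have [gx0 gT] := related_orth Tg.
(* The defect in the graph equation at [n = 0], where the partial sums are 0 and [coef g 0]. *)
pose c := u 0 - coef g 0.
have uE n : u n = psum g n + psum g n.+1 + c.
  elim: n => [|n IH]; first by rewrite psumS psum0 /c; lra.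
  have [f [fJ Tf]] := skewop_diff n.
  (* This reads [coef g n + coef g n.+1 + (u n - u n.+1) = 0], so the defect is the same at [n] and
     [n.+1]. *)
  have := gT _ _ Tf; rewrite xu fJ linearD linearD -/(coef g n) -/(coef g n.+1).
  by rewrite IH (psumS g n.+1) (psumS g n); lra.
have c_tsum : tsum g + tsum g + c = 0.
  apply: (cvgn_unique _ (@c0_cvg _ u)).
  rewrite (funext uE : (u : nat -> R^o) = _).
  by apply: cvgD; [exact: psum_avg_cvg|exact: cvg_cst].
have gxE : (g x : R) = tsum g ^+ 2 + c * tsum g.
  rewrite xu; apply: (cvgn_unique (@dual_trunc_cvg g u)).
  rewrite (_ : (fun n => _) = fun n => psum g n ^+ 2 + c * psum g n).
    rewrite expr2; under eq_fun do rewrite expr2.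
    by apply: cvgD; [apply: cvgM|apply: cvgMl_tmp]; exact: psum_cvg.
  apply/funext => n; rewrite -sum_psum /psum mulr_sumr -big_split /=.
  by apply: eq_bigr => k _; rewrite uE mulrDl.
have s0 : tsum g = 0.
  have cE : c = - (tsum g + tsum g) by lra.
  apply/eqP; rewrite -sqrf_eq0 eq_le sqr_ge0 andbT.
  by move: gx0; rewrite gxE cE expr2; lra.
have c0 : c = 0 by lra.
by exists u; split => // n; rewrite uE c0 addr0.
Qed.

Lemma skewop_maximal_monotone : maximal_monotone skewop.
Proof.
split; first exact: skewop_monotone.
move=> S mS TS; apply/seteqP; split => // -[x g] Sg; apply: skewop_maximal => y f Tf.
exact: (mS (x, g) (y, f) Sg (TS (y, f) Tf)).
Qed.

(** * Failure of type (D) *)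

Lemma skewop_not_type_D : ~ gossez_type_D skewop.
Proof.
have [g [gJ g_norm]] := coordinate_functional 0.
(* [xi] pairs [coef f] with [(1, 2, 2, ...)], which is [psum g n + psum g n.+1]: the graph equation
   holds for [g], but with a sequence outside [c0]. *)
pose xi (f : dual X) : R^o := tsum f + tsum f - coef f 0.
have [||xx xxE] := @bounded_linear_dual R (dual X) xi 3.
- move=> l f h; rewrite /xi tsumD tsumZ -[coef _ 0]/(l * coef f 0 + coef h 0).
  by rewrite -[l *: _]/(l * _); ring.
- move=> f; have := tsum_le f; have : `|coef f 0| <= `|f|.
    by have := sum_abs_coef f 1; rewrite big_ord1.
  rewrite /xi => cf tf.
  have := ler_normB (tsum f + tsum f) (coef f 0).
  by have := ler_normD (tsum f) (tsum f); lra.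
have psumg n : psum g n = (0 < n)%:R.
  elim: n => [|n IH]; first by rewrite psum0.
  by rewrite psumS IH /coef gJ c0_unitE; case: n {IH} => [|n]; rewrite ?add0r ?addr0.
have tg : tsum g = 1.
  apply: tsum_eq; apply: cvg_near_cst; exists 1%N => // n /= n1.
  by rewrite psumg n1.
have gc : graph (gossez_closure skewop) (xx, g).
  move=> [y f] Tf; have {}Tf : skewop y f := Tf.
  have := skewop_orth Tf; have := skewop_tsum Tf; case: Tf => u [-> uE] tf fu.
  have -> : (xx - bidual_embedding (J u)) (g - f) =
      (xi g : R) - (xi f : R) - ((g (J u) : R) - (f (J u) : R)) :> R.
    by rewrite dualB linearB/= !xxE.
  have cg : coef g 0 = 1 by rewrite /coef gJ c0_unitE.
  (* The pairing equals 1: [xi g = 1], [xi f = - coef f 0], [g (J u) = u 0 = coef f 0] and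
     [f (J u) = 0]. *)
  by rewrite /xi fu tf tg gJ uE psumS psum0 cg; lra.
move=> /(_ _ _ gc)[I [le [net [dir netT _ _ netg]]]].
have PF := net_filter_proper dir.
(* Some [(net i).2] would lie at distance less than 1 from [g], yet [tsum] has norm at most 1 and
   takes the value 1 on the difference. *)
have /cvgrPdist_lt/(_ 1 ltr01)/filter_ex[i /=] := netg.
apply/negP; rewrite -leNgt (le_trans _ (tsum_le _))//.
by rewrite -scaleN1r tsumD tsumZ (skewop_tsum (netT i)) tg mulr0 addr0 normr1.
Qed.

End isometric_c0.

Theorem corollary2p4 (R : realType) (X : completeNormedModType R)
  (hX : contains_isometric_copy_of_c0 X) :
  exists T : X -> set (dual X), maximal_monotone T /\ ~ gossez_type_D T.
Proof.
have [J normJ] := hX; exists (skewop J); split.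
- exact: skewop_maximal_monotone.
- exact: skewop_not_type_D.
Qed.
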